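(* Let $n\ge 1$ and let $A=(a_{ij})_{n\times n}$ be an $n\times n$ matrix with entries in a commutative ring. Then $$\det(A)=\sum_{B\vdash[n]}(-1)^{n-|B|}\prod_{\beta_k\in B}\ \prod_{j\in\beta_k}\ \sum_{i\in\beta_k'}a_{ij},$$ where the outer summation runs over all ordered partitions $B=(\beta_1,\beta_2,\ldots,\beta_r)$ of the set $[n]$, $|B|=r$ is the number of parts of $B$, and the inner summation runs over all integers $i$ in the union of the first $k$ parts $\beta_k'=\bigcup_{j=1}^k\beta_j$ of $B$.
   Context: $[n]=\{1,2,\ldots,n\}$. An ordered partition $B=(\beta_1,\ldots,\beta_r)$ of $[n]$, written $B\vdash[n]$, is a finite sequence of nonempty, pairwise disjoint subsets (the parts) of $[n]$ whose union is $[n]$; the order of the parts matters, the order of elements within a part does not. $|B|=r$ denotes the number of parts. *)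

(* Defs.v *)
From HB Require Import structures.
From mathcomp Require Import all_boot all_order all_algebra.
Set Implicit Arguments.
Unset Strict Implicit.
Unset Printing Implicit Defensive.

(* The order of the parts is their order of occurrence in the sequence. *)
Definition ordered_partition (T : finType) (B : seq {set T}) : bool :=
  [&& set0 \notin B,
      pairwise (fun X Y : {set T} => [disjoint X & Y]) B
    & \bigcup_(X <- B) X == [set: T]].

(* Parts are numbered from 0, so [part_union B k] is the union of the first   *)
(* k + 1 parts, including part k itself.                                      *)
Definition part_union (T : finType) (B : seq {set T}) (k : nat) : {set T} :=
  \bigcup_(X <- take k.+1 B) X.

(* An ordered partition of a set with n elements has at most n parts, so      *)
(* every ordered partition of 'I_n is an element of the finite type           *)
(* [n.-bseq {set 'I_n}] of sequences of length at most n.                     *)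
Lemma size_ordered_partition (T : finType) (B : seq {set T}) :
  ordered_partition B -> size B <= #|T|.
Proof.
case/and3P=> B0 dB _.
suff: size B <= #|\bigcup_(X <- B) X| by move/leq_trans; apply; exact: max_card.
elim: B B0 dB => [|X B IH] //=.
rewrite inE negb_or big_cons => /andP[X0 B0] /andP[dX dB].
have dXB: X :&: \bigcup_(Y <- B) Y = set0.
  apply/eqP; rewrite setI_eq0 disjoint_sym.
  elim: B dX {IH B0 dB} => [|Y B IH] /=.
    by rewrite big_nil disjoints_subset sub0set.
  case/andP=> dXY dX; rewrite big_cons -setI_eq0 setIUl setU_eq0 !setI_eq0.
  by rewrite disjoint_sym dXY IH.
rewrite cardsU dXB cards0 subn0 -add1n leq_add ?IH //.
by rewrite card_gt0 eq_sym.
Qed.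

(* Main.v *)
Require Import Defs.
From HB Require Import structures.
From mathcomp Require Import all_boot all_order all_algebra.
Set Implicit Arguments.
Unset Strict Implicit.
Unset Printing Implicit Defensive.
Import GRing.Theory.
Local Open Scope ring_scope.

(** Let [D(U)] be the sum on the right-hand side with [U] in place of [n], that
    is, over the ordered partitions of [U] and with the exponent
    [#|U| - size B]. Splitting off the last part [X] of a partition of a
    nonempty [U] (for which the union of the parts so far is all of [U]) gives

      D(U) = \sum_(X nonempty, X <= U)
               (-1)^(#|X| - 1) (\prod_(j in X) r_j) D(U \ X),

    where [r_j = \sum_(i in U) A i j] is the sum of the column [j] of the
    submatrix [A[U]] on the rows and columns in [U]. The principal minors of
    [A] satisfy the same recurrence, by the argument used for the matrix-tree
    theorem: the matrix obtained from [A[U]] by subtracting [r_j] from its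
    [j]-th diagonal entry has zero column sums, so its determinant vanishes,
    and expanding this determinant along the diagonal correction yields

      \sum_(X <= U) (\prod_(j in X) - r_j) \det A[U \ X] = 0

    ([principal_minor_sum0]); isolating the term where [X] is empty is the
    recurrence ([principal_minor_rec]). Since both sides are 1 at the empty
    set, [D(U) = \det A[U]] for all [U]
    ([principal_minor_ordered_partitions]), and [U = [n]] is the theorem.

    To run the induction, the ordered partitions of a set are enumerated by a
    recursive program that appends the last part ([ordered_partitions]);
    [big_ordered_partition] identifies this enumeration with the index set of
    the theorem. *)

(** * A recurrence for principal minors *)

Lemma det_add_rows (R : comPzRingType) (n : nat) (X Y : 'M[R]_n) :
  \det (X + Y) =
    \sum_(J : {set 'I_n})
      \det (\matrix_(i, j) (if i \in J then X i j else Y i j)).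
Proof.
rewrite /determinant exchange_big /=; apply: eq_bigr => s _.
rewrite -big_distrr /=; congr (_ * _).
under eq_bigr do rewrite mxE.
rewrite bigA_distr; apply: eq_bigr => J _.
by apply: eq_bigr => i _; rewrite mxE.
Qed.

(** Over a ring with zero divisors a nonzero kernel vector does not make the
    determinant vanish; the adjugate shows that the determinant annihilates the
    entries of the vector. *)
Lemma det_mul_ker (R : comPzRingType) (n : nat) (N : 'M[R]_n) (v : 'cV[R]_n) i :
  N *m v = 0 -> \det N * v i 0 = 0.
Proof.
move=> Nv; have : \adj N *m (N *m v) = 0 by rewrite Nv mulmx0.
by rewrite mulmxA mul_adj_mx mul_scalar_mx => /matrixP/(_ i 0); rewrite !mxE.
Qed.

(** The determinant of this matrix is the principal minor of [A] on [U]: it is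
    block triangular, with an identity block outside [U]. Keeping the full size
    avoids reindexing by the elements of [U]. It is transposed with respect to
    [A], so that the columns of [A] become rows and the multilinearity of the
    determinant applies in the form of [det_add_rows]. *)
Definition principal_mx (R : comPzRingType) (n : nat) (A : 'M[R]_n)
    (U : {set 'I_n}) : 'M[R]_n :=
  \matrix_(j, i) (if j \in U then A i j else (j == i)%:R).

Definition partial_colsum (R : comPzRingType) (n : nat) (A : 'M[R]_n)
    (U : {set 'I_n}) (j : 'I_n) : R :=
  \sum_(i in U) A i j.

(** Expanding [\det (D + principal_mx A U)], where [D] is the diagonal matrix
    with entries [- partial_colsum A U j] for [j] in [U] and zero elsewhere,
    gives the left-hand side. This determinant is 0 because the indicator vector
    of [U] is in the kernel. *)
Lemma principal_minor_sum0 (R : comPzRingType) (n : nat) (A : 'M[R]_n)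
    (U : {set 'I_n}) : U != set0 ->
  \sum_(X : {set 'I_n} | X \subset U)
    (\prod_(j in X) - partial_colsum A U j) * \det (principal_mx A (U :\: X))
  = 0.
Proof.
case/set0Pn=> u uU.
pose D : 'M[R]_n :=
  diag_mx (\row_j (if j \in U then - partial_colsum A U j else 0)).
have DE j i : D j i = (if j \in U then - partial_colsum A U j else 0) *+ (j == i).
  by rewrite !mxE.
have detDA : \det (D + principal_mx A U) = 0.
  pose v : 'cV[R]_n := \col_i (i \in U)%:R.
  rewrite -[LHS]mulr1.
  (* The kernel vector has an entry equal to 1, because U is not empty. *)
  have <- : v u 0 = 1 by rewrite mxE uU.
  apply: det_mul_ker; apply/matrixP=> j k; rewrite !mxE.
  under eq_bigr => i _ do rewrite [v i k]mxE mulr_natr mulrb.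
  rewrite -big_mkcond /=.
  under eq_bigr => i _ do rewrite mxE DE [principal_mx _ _ _ _]mxE.
  rewrite big_split /=; have [jU|jU] := ifP.
    rewrite (bigD1 j) //= eqxx mulr1n big1 ?addr0 ?addNr // => i /andP[_].
    by rewrite eq_sym => /negPf->.
  rewrite !big1 ?addr0 // => i iU; last by rewrite mul0rn.
  by case: eqP => // ji; rewrite ji iU in jU.
rewrite -[RHS]detDA det_add_rows.
rewrite [RHS](bigID (fun X : {set 'I_n} => X \subset U)) /=.
(* If X is not contained in U, then some row taken from D is zero. *)
rewrite [X in _ = _ + X]big1 ?addr0; last first.
  move=> X /subsetPn[j jX jU]; rewrite (expand_det_row _ j) big1 // => i _.
  by rewrite !mxE jX (negPf jU) mul0rn mul0r.
(* Taking the rows in X from D amounts to scaling the rows of the matrix of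
   U :\: X, because the rows in X of that matrix are those of the identity. *)
apply: eq_bigr => X XU.
set d : 'rV[R]_n := \row_j (if j \in X then - partial_colsum A U j else 1).
have -> : \prod_(j in X) - partial_colsum A U j = \det (diag_mx d).
  by rewrite det_diag big_mkcond; apply: eq_bigr => j _; rewrite !mxE.
rewrite -det_mulmx; congr (\det _); apply/matrixP=> j i.
rewrite mul_diag_mx !mxE inE; case: ifP => jX /=; last by rewrite mul1r.
by rewrite (subsetP XU) // mulr_natr.
Qed.

Lemma principal_minor0 (R : comPzRingType) (n : nat) (A : 'M[R]_n) :
  \det (principal_mx A set0) = 1.
Proof.
by rewrite -(det1 R n); congr (\det _); apply/matrixP=> i j; rewrite !mxE inE.
Qed.

Lemma principal_minor_rec (R : comPzRingType) (n : nat) (A : 'M[R]_n)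
    (U : {set 'I_n}) : U != set0 ->
  \det (principal_mx A U) =
  \sum_(X : {set 'I_n} | (X != set0) && (X \subset U))
    (-1) ^+ #|X|.+1 * (\prod_(j in X) partial_colsum A U j)
      * \det (principal_mx A (U :\: X)).
Proof.
move/(principal_minor_sum0 A); rewrite (bigD1 set0) ?sub0set //=.
rewrite big_set0 mul1r setD0 => /eqP; rewrite addr_eq0 => /eqP->.
rewrite -sumrN; apply: eq_big => [X|X _]; first by rewrite andbC.
by rewrite prodrN exprS !mulN1r !mulNr.
Qed.

(** * Ordered partitions, built by appending the last part *)

Definition ordered_partition_of (T : finType) (U : {set T}) (B : seq {set T}) :=
  [&& set0 \notin B,
      pairwise (fun X Y : {set T} => [disjoint X & Y]) B
    & \bigcup_(X <- B) X == U].

Lemma ordered_partition_of_rcons (T : finType) (U : {set T})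
    (B : seq {set T}) (X : {set T}) :
  ordered_partition_of U (rcons B X) =
  [&& X != set0, X \subset U & ordered_partition_of (U :\: X) B].
Proof.
have all_disj : all (fun Y : {set T} => [disjoint Y & X]) B
    = [disjoint \bigcup_(Y <- B) Y & X].
  elim: B => [|Y B IH] /=; first by rewrite big_nil -setI_eq0 set0I eqxx.
  by rewrite big_cons IH -!setI_eq0 setIUl setU_eq0.
rewrite /ordered_partition_of mem_rcons inE negb_or eq_sym.
rewrite pairwise_rcons all_disj -cats1 big_cat big_seq1 /=.
set V := \bigcup_(Y <- B) Y.
case: (X != set0); case: (set0 \notin B); rewrite ?andbF //=.
case: (pairwise _ B); rewrite ?andbF //= andbT.
apply/andP/andP => [[dVX /eqP<-]|[XU /eqP->]].
  rewrite subsetUr setDUl setDv setU0; split=> //; apply/eqP.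
  by apply/esym/setDidPl.
split; first by rewrite -setI_eq0 setIDAC setDIl setDv setI0.
by rewrite setUC -{1}(setIidPr XU) setID.
Qed.

Lemma card_setD_leq (T : finType) (U X : {set T}) (m : nat) :
  (#|U| <= m.+1)%N -> X != set0 -> X \subset U -> (#|U :\: X| <= m)%N.
Proof.
move=> Um X0 XU; rewrite -ltnS (leq_trans _ Um) //.
rewrite cardsD (setIidPr XU) ltn_subrL card_gt0 X0 /=.
by rewrite (leq_trans _ (subset_leq_card XU)) ?card_gt0.
Qed.

(** The natural number [m] only makes the recursion structural: the list is
    complete as soon as [#|U| <= m]. *)
Fixpoint ordered_partitions (T : finType) (m : nat) (U : {set T}) :
    seq (seq {set T}) :=
  if m is m'.+1 then
    if U == set0 then [:: [::]] else
    [seq rcons B X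
       | X <- [seq X <- enum {set T} | (X != set0) && (X \subset U)],
         B <- ordered_partitions m' (U :\: X)]
  else [:: [::]].

Lemma ordered_partition_of0 (T : finType) (B : seq {set T}) :
  ordered_partition_of set0 B = (B == [::]).
Proof.
case/lastP: B => [|B X]; first by rewrite /ordered_partition_of big_nil eqxx.
rewrite ordered_partition_of_rcons subset0 andbA andNb.
by case: B.
Qed.

Lemma ordered_partitions0 (T : finType) m :
  ordered_partitions m (set0 : {set T}) = [:: [::]].
Proof. by case: m => //= m; rewrite eqxx. Qed.

Lemma mem_ordered_partitions (T : finType) (m : nat) (U : {set T}) B :
  (#|U| <= m)%N -> (B \in ordered_partitions m U) = ordered_partition_of U B.
Proof.
elim: m U B => [|m IH] U B Um.
  have /eqP-> : U == set0 by rewrite -cards_eq0 -leqn0.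
  by rewrite ordered_partition_of0 inE.
have [->|U0] := eqVneq U set0.
  by rewrite ordered_partitions0 ordered_partition_of0 inE.
rewrite /= (negPf U0); apply/allpairsPdep/idP => [[X [B' [XU B'X ->]]]|].
  move: XU; rewrite mem_filter => /andP[/andP[X0 XU] _].
  by rewrite ordered_partition_of_rcons X0 XU -IH ?card_setD_leq.
case/lastP: B => [|B X].
  by rewrite /ordered_partition_of big_nil eq_sym (negPf U0).
rewrite ordered_partition_of_rcons => /and3P[X0 XU BX].
by exists X, B; rewrite mem_filter X0 XU mem_enum IH ?card_setD_leq.
Qed.

Lemma ordered_partitions_uniq (T : finType) (m : nat) (U : {set T}) :
  uniq (ordered_partitions m U).
Proof.
elim: m U => [|m IH] U //=; case: ifP => // _.
apply: allpairs_uniq_dep => [|X _|[X B] [Y C] _ _ /= /rcons_inj[-> ->]] //.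
by rewrite filter_uniq ?enum_uniq.
Qed.

Lemma big_ordered_partition (R : nmodType) (T : finType) (m : nat)
    (F : seq {set T} -> R) : (#|T| <= m)%N ->
  \sum_(B : m.-bseq {set T} | ordered_partition B) F B =
  \sum_(B <- ordered_partitions m [set: T]) F B.
Proof.
move=> Tm; rewrite -big_filter.
rewrite -(big_map (fun B : m.-bseq _ => B : seq _) xpredT F).
apply: perm_big; apply: uniq_perm => [||B].
- rewrite map_inj_uniq ?filter_uniq ?index_enum_uniq //; exact: val_inj.
- exact: ordered_partitions_uniq.
rewrite mem_ordered_partitions ?cardsT //; apply/mapP/idP => [[C]|BT].
  by rewrite mem_filter => /andP[oC _] ->.
have Bm : (size B <= m)%N by apply: leq_trans (size_ordered_partition BT) Tm.
by exists (Bseq Bm); rewrite // mem_filter mem_index_enum andbT.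
Qed.

(** * Comparison of the two recurrences *)

Definition partition_weight (R : comPzRingType) (n : nat) (A : 'M[R]_n)
    (B : seq {set 'I_n}) : R :=
  \prod_(k < size B) \prod_(j in nth set0 B k)
    partial_colsum A (part_union B k) j.

Lemma partition_weight0 (R : comPzRingType) (n : nat) (A : 'M[R]_n) :
  partition_weight A [::] = 1.
Proof. exact: big_ord0. Qed.

(** Only the last factor involves [X], because the union of the first parts up
    to the part [k] does not depend on later parts. *)
Lemma partition_weight_rcons (R : comPzRingType) (n : nat) (A : 'M[R]_n)
    (U X : {set 'I_n}) (B : seq {set 'I_n}) :
  ordered_partition_of U (rcons B X) ->
  partition_weight A (rcons B X) =
    partition_weight A B * \prod_(j in X) partial_colsum A U j.
Proof.
case/and3P=> _ _ /eqP UE.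
rewrite /partition_weight size_rcons big_ord_recr /= nth_rcons ltnn eqxx.
rewrite /part_union take_oversize ?size_rcons // UE; congr (_ * _).
apply: eq_bigr => k _; rewrite nth_rcons ltn_ord; apply: eq_bigr => j _.
by rewrite -cats1 takel_cat.
Qed.

(** Here the sign exponent is [#|U| + size B] rather than the difference: both
    have the same parity, and the sum needs no side condition in the
    induction. *)
Lemma principal_minor_ordered_partitions (R : comPzRingType) (n m : nat)
    (A : 'M[R]_n) (U : {set 'I_n}) : (#|U| <= m)%N ->
  \det (principal_mx A U) =
  \sum_(B <- ordered_partitions m U)
    (-1) ^+ (#|U| + size B) * partition_weight A B.
Proof.
elim: m U => [|m IH] U Um; have [->|U0] := eqVneq U set0.
- by rewrite ordered_partitions0 big_seq1 cards0 mul1r principal_minor0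
             partition_weight0.
- by move: U0; rewrite -cards_eq0 -leqn0 Um.
- by rewrite ordered_partitions0 big_seq1 cards0 mul1r principal_minor0
             partition_weight0.
rewrite principal_minor_rec //= (negPf U0).
rewrite big_allpairs_dep big_filter big_enum_cond.
apply: eq_bigr => X /andP[X0 XU].
have UXm : (#|U :\: X| <= m)%N by apply: card_setD_leq.
rewrite (IH _ UXm) big_distrr /= big_seq [RHS]big_seq; apply: eq_bigr => B.
rewrite mem_ordered_partitions // => BX.
rewrite (@partition_weight_rcons _ _ _ U) ?ordered_partition_of_rcons ?X0 ?XU //.
rewrite size_rcons -[#|U|](cardsID X) (setIidPr XU).
rewrite mulrACA -exprD; congr (_ ^+ _ * _); last exact: mulrC.
by rewrite addSn addnS addnA.
Qed.

Theorem theorem1 (R : comPzRingType) (n : nat) (hn : (1 <= n)%N)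
    (A : 'M[R]_n) :
  \det A =
    \sum_(B : n.-bseq {set 'I_n} | ordered_partition B)
      (-1) ^+ (n - size B)%N *
      \prod_(k < size B) \prod_(j in nth set0 B k)
        \sum_(i in part_union B k) A i j.
Proof.
transitivity (\det (principal_mx A setT)).
  by rewrite -det_tr; congr (\det _); apply/matrixP=> i j; rewrite !mxE inE.
rewrite (@principal_minor_ordered_partitions _ n n) ?max_card //; last first.
  by rewrite cardsT card_ord.
rewrite -big_ordered_partition ?card_ord //.
apply: eq_bigr => B _; congr (_ * _); rewrite cardsT card_ord.
by rewrite -signr_odd oddD -oddB ?size_bseq // signr_odd.
Qed.
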